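(* Let $s>0$, and let $n$ range over positive integers with $n>2s$. (1) For any $\varepsilon_1>0$ there exists $n_1(s,\varepsilon_1)$ such that $a_{n,s}<1+\varepsilon_1$ whenever $$n>\overline n_1(s,\varepsilon_1):=\max\left\{\left(1+\varepsilon_1+\sqrt{\max\{(1+\varepsilon_1)^2+2s-2,0\}}\right)^2,\ n_1(s,\varepsilon_1)\right\},$$ where $n_1(s,\varepsilon_1)$ is the largest real root of the following equation in the variable $n$: $$(-\varepsilon_1^2-2\varepsilon_1)n^4+\big[-27+(18s+48)(1+\varepsilon_1)^2\big]n^3+\big[(-36s^2-96s-144)(1+\varepsilon_1)^2-24s^2-30s+88\big]n^2$$ $$+\big[(24s^3+192s^2+288s+192)(1+\varepsilon_1)^2+60s^2+64s-144\big]n+48s^4+216s^3+352s^2+288s+192=0.$$ (2) For any $\varepsilon_2>0$ there exists $n_2(s,\varepsilon_2)$ such that $a_{n,s}>1-\varepsilon_2$ whenever $$n>\overline n_2(s,\varepsilon_2):=\max\left\{\left(1-\varepsilon_2+\sqrt{\max\{(1-\varepsilon_2)^2+2s-2,0\}}\right)^2,\ n_2(s,\varepsilon_2)\right\},$$ where $n_2(s,\varepsilon_2)$ is the square of the largest real root of the following equation in the variable $t$: $$(\varepsilon_2^2+2\varepsilon_2)t^6-2(1-\varepsilon_2)^3t^5+\big[18(1-\varepsilon_2)^2-18s-39\big]t^4+\big[-4(1-\varepsilon_2)^3s-6(1-\varepsilon_2)\big]t^3$$ $$+\big[(12s^2+36s)(1-\varepsilon_2)^2+36s^2+144s+158\big]t^2-12(1-\varepsilon_2)st-24s^3-132s^2-260s-192=0.$$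 (3) For any fixed $s>0$, $\lim_{n\to+\infty}a_{n,s}=1$.
   Context: $\Gamma$ is the Gamma function. For a positive integer $n$ and real $s$ with $0<s<n/2$, the function $f_{n,s}$ is defined for real $a$ with $-\frac12\frac{n-2s}{\sqrt n}-\frac1{\sqrt n}<a<\frac12\frac{n-2s}{\sqrt n}+\frac1{\sqrt n}$ (so that all Gamma arguments are positive) by $$f_{n,s}(a)=\ln\Gamma\left(\tfrac n4+\tfrac s2+\tfrac12+\tfrac12a\sqrt n\right)+\ln\Gamma\left(\tfrac n4+\tfrac s2+\tfrac12-\tfrac12a\sqrt n\right)-2\ln\Gamma\left(\tfrac n4+\tfrac s2\right)$$ $$\qquad-\ln\Gamma\left(\tfrac n4-\tfrac s2+\tfrac12+\tfrac12a\sqrt n\right)-\ln\Gamma\left(\tfrac n4-\tfrac s2+\tfrac12-\tfrac12a\sqrt n\right)+2\ln\Gamma\left(\tfrac n4-\tfrac s2\right).$$ The number $a_{n,s}$ is the unique positive root of $f_{n,s}$ in this domain; it satisfies $\frac{1}{\sqrt n}<a_{n,s}<\frac12\frac{n-2s}{\sqrt n}+\frac{1}{\sqrt n}$. *)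

(* Defs.v *)
From HB Require Import structures.
From mathcomp Require Import all_boot all_order all_algebra.
From mathcomp Require Import all_classical all_reals all_analysis.

Set Implicit Arguments.
Unset Strict Implicit.
Unset Printing Implicit Defensive.

Import Order.TTheory GRing.Theory Num.Theory.
Import numFieldNormedType.Exports.

Local Open Scope classical_set_scope.
Local Open Scope ring_scope.

(* Euler's integral; it converges for 0 < x and is only used there. *)
Definition Gamma (R : realType) (x : R) : R :=
  \int[@lebesgue_measure R]_(t in `]0, +oo[) (t `^ (x - 1) * expR (- t)).

Definition lnGamma (R : realType) (x : R) : R := ln (Gamma x).

Definition f_fun (R : realType) (n : nat) (s a : R) : R :=
  let N : R := n%:R in
  let r := a * Num.sqrt N / 2 in
  lnGamma (N / 4 + s / 2 + 1 / 2 + r) + lnGamma (N / 4 + s / 2 + 1 / 2 - r)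
  - 2 * lnGamma (N / 4 + s / 2)
  - lnGamma (N / 4 - s / 2 + 1 / 2 + r) - lnGamma (N / 4 - s / 2 + 1 / 2 - r)
  + 2 * lnGamma (N / 4 - s / 2).

Definition f_dom (R : realType) (n : nat) (s : R) : set R :=
  let N : R := n%:R in
  let b := 1 / 2 * ((N - 2 * s) / Num.sqrt N) + 1 / Num.sqrt N in
  [set a | - b < a /\ a < b].

Definition positive_root (R : realType) (n : nat) (s : R) : set R :=
  [set a | [/\ 0 < a, f_dom n s a & f_fun n s a = 0]].

(* Definite description; the default 0 is returned when the positive root does
   not exist or is not unique, which does not happen for 0 < s < n / 2. *)
Definition a_root (R : realType) (n : nat) (s : R) : R :=
  xget 0 [set a | unique (positive_root n s) a].

Definition largest_root (R : realType) (p : {poly R}) (x : R) : Prop :=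
  root p x /\ forall y : R, root p y -> y <= x.

Definition poly_n1 (R : realType) (s e : R) : {poly R} :=
  (- e ^+ 2 - 2 * e) *: 'X^4
  + (- 27 + (18 * s + 48) * (1 + e) ^+ 2) *: 'X^3
  + ((- 36 * s ^+ 2 - 96 * s - 144) * (1 + e) ^+ 2
      - 24 * s ^+ 2 - 30 * s + 88) *: 'X^2
  + ((24 * s ^+ 3 + 192 * s ^+ 2 + 288 * s + 192) * (1 + e) ^+ 2
      + 60 * s ^+ 2 + 64 * s - 144) *: 'X
  + (48 * s ^+ 4 + 216 * s ^+ 3 + 352 * s ^+ 2 + 288 * s + 192)%:P.

Definition poly_n2 (R : realType) (s e : R) : {poly R} :=
  (e ^+ 2 + 2 * e) *: 'X^6
  - (2 * (1 - e) ^+ 3) *: 'X^5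
  + (18 * (1 - e) ^+ 2 - 18 * s - 39) *: 'X^4
  + (- 4 * (1 - e) ^+ 3 * s - 6 * (1 - e)) *: 'X^3
  + ((12 * s ^+ 2 + 36 * s) * (1 - e) ^+ 2
      + 36 * s ^+ 2 + 144 * s + 158) *: 'X^2
  - (12 * (1 - e) * s) *: 'X
  + (- 24 * s ^+ 3 - 132 * s ^+ 2 - 260 * s - 192)%:P.

Definition sqrt_bound (R : realType) (s c : R) : R :=
  (c + Num.sqrt (Num.max (c ^+ 2 + 2 * s - 2) 0)) ^+ 2.

(* Main.v *)
Require Import Defs.
From HB Require Import structures.
From mathcomp Require Import all_boot all_order all_algebra.
From mathcomp Require Import all_classical all_reals all_analysis.
From mathcomp Require Import ring lra.
Import Order.TTheory GRing.Theory Num.Theory.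
Import numFieldNormedType.Exports.
Local Open Scope classical_set_scope.
Local Open Scope ring_scope.

(** Put p = n/4 + s/2, q = n/4 - s/2, r = a * sqrt n / 2 and
    rho = r^2 - 1/4. With L = ln Gamma and
      spread x r = L (x + 1/2 + r) + L (x + 1/2 - r) - 2 * L x,
    the function of the theorem is spread p r - spread q r.

    The functional equation of Gamma shows that
      W k x = spread x r - ln x - k / x
    satisfies W k (x + 1) - W k x = ln (1 - rho * v) + k * v with
    v = 1 / (x * (x + 1)), and log-convexity of Gamma shows that
    W k (x + N) tends to 0 as N grows. If the increment is monotone in x, then
    W k (p + N) - W k (q + N) is a monotone sequence with limit 0, so the sign
    of its first term is known ([corrected_spread_le]). The increment
    increases with x for k = rho, and decreases for k = rho + 1 as long as
    rho <= x. Replacing ln p - ln q by rational bounds, this gives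
      spread p r < spread q r   if rho > p        ([spread_diff_lt0]),
      spread p r > spread q r   if rho < q - 1    ([spread_diff_gt0]).
    The same comparison between two values of r shows that
    spread p r - spread q r is strictly decreasing in r. It is positive at
    r = 1/2 and nonpositive near r = q + 1/2, hence it has exactly one zero
    r > 0, which lies between 1/2 and q + 1/2. So a_{n,s} is well defined, and
      n - 2 * s - 3 <= a_{n,s}^2 * n <= n + 2 * s + 1.
    In particular a_{n,s} tends to 1.

    The explicit thresholds are weaker than this two-sided bound. Beyond its
    largest root the quartic is negative, and negativity at n implies
    (1 + e)^2 * n > n + 2 * s + 1 ([poly_n1_ge0]). Beyond its largest root the
    sextic is positive. If c = 1 - e and c * sqrt n > 1 but
    c^2 * n >= n - 2 * s - 3, then t^2 * (1 - c^2) = 2 * s + 3 defines a point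
    t >= sqrt n where the sextic is nonpositive ([poly_n2_le0]), which is
    impossible.

    About Gamma itself only two facts are used, the functional equation
    ([lnGamma_succ]) and log-convexity ([lnGamma_convex]). Both are proved for
    Euler's integral over the segments [1/(N+2), N+2] and passed to the
    limit. *)

Set Implicit Arguments.
Unset Strict Implicit.
Unset Printing Implicit Defensive.

(** * Elementary limits and logarithm inequalities *)

Lemma ln_le_tangent (R : realType) (x b : R) :
  0 < x -> 0 < b -> ln b <= b / x - 1 + ln x.
Proof.
move=> x0 b0; have bx : 0 < b / x by rewrite divr_gt0.
have -> : ln b = ln (b / x) + ln x by rewrite -lnM ?posrE// divfK ?gt_eqF.
rewrite lerD2r -[in leLHS](subrK 1 (b / x)) addrC; apply: le_ln1Dx; lra.
Qed.

Lemma nondecreasing_cvg0_le0 (R : realType) (u : R^nat) :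
  (forall N, u N <= u N.+1) -> u @ \oo --> (0 : R) -> forall N, u N <= 0.
Proof.
move=> /nondecreasing_seqP nd cv N.
have := nondecreasing_cvgn_le nd (cvgP _ cv) N.
by rewrite (cvg_lim _ cv).
Qed.

Lemma cvg_inv_shift (R : realType) (C x : R) :
  C / (x + N%:R) @[N --> \oo] --> (0 : R).
Proof.
rewrite -[X in _ --> X](mulr0 C); apply: cvgMr; apply: (gtr0_cvgV0 _).2.
  near=> N; rewrite -ltrBlDl sub0r; near: N; exact: nbhs_infty_gtr.
apply/cvgryPge => A; near=> N; rewrite -lerBlDl; near: N; exact: nbhs_infty_ger.
Unshelve. all: by end_near. Qed.

Section log_inequalities.
Variable R : realType.
Implicit Types a b x y v w rho : R.

Lemma pronic_inv_le x y :
  0 < x -> x <= y -> (y * (y + 1))^-1 <= (x * (x + 1))^-1.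
Proof. by move=> x0 xy; rewrite lef_pV2 ?posrE; nra. Qed.

(** ln (1 - rho * v) + rho * v is nonincreasing in v because ln (1 - u) + u has
    derivative - u / (1 - u). *)
Lemma ln_sub_add_le rho v w : 0 <= rho -> 0 <= w -> w <= v -> rho * v < 1 ->
  ln (1 - rho * v) + rho * v <= ln (1 - rho * w) + rho * w.
Proof.
move=> r0 w0 wv rv.
have rw : rho * w <= rho * v by rewrite ler_wpM2l.
have a0 : 0 < 1 - rho * w by lra.
have /(ln_le_tangent a0) : 0 < 1 - rho * v by lra.
have : (1 - rho * v) / (1 - rho * w) <= 1 - (rho * v - rho * w).
  rewrite ler_pdivrMr//; have : 0 <= rho * w by rewrite mulr_ge0.
  nra.
lra.
Qed.

(** With the coefficient rho + 1 the derivative in v is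
    rho + 1 - rho / (1 - rho * v), which is nonnegative exactly as long as
    rho * (rho + 1) * v <= 1. *)
Lemma ln_sub_add_ge rho v w : 0 <= rho -> 0 <= w -> w <= v ->
  rho * (rho + 1) * v <= 1 ->
  ln (1 - rho * w) + (rho + 1) * w <= ln (1 - rho * v) + (rho + 1) * v.
Proof.
move=> r0 w0 wv rv.
have v0 : 0 <= v by lra.
have rw : rho * w <= rho * v by rewrite ler_wpM2l.
have rv1 : rho * v < 1.
  have [->|v1] := eqVneq v 0; first by rewrite mulr0.
  have vp : 0 < v by rewrite lt0r v1.
  have : 0 <= rho * v by rewrite mulr_ge0.
  nra.
have a0 : 0 < 1 - rho * v by lra.
have /(ln_le_tangent a0) : 0 < 1 - rho * w by lra.
have : (1 - rho * w) / (1 - rho * v) <= 1 + (rho + 1) * (v - w).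
  rewrite ler_pdivrMr//.
  have : 0 <= (v - w) * (1 - rho * (rho + 1) * v) by rewrite mulr_ge0//; lra.
  nra.
lra.
Qed.

(** The ratio (x^2 - b^2) / (y^2 - b^2) decreases with b, since its numerator is
    relatively more sensitive to b than its denominator. *)
Lemma ln_sub_sqr_cross a b x y : 0 <= a -> a < b -> b < x -> x < y ->
  ln (x + b) + ln (x - b) + (ln (y + a) + ln (y - a)) <
  ln (x + a) + ln (x - a) + (ln (y + b) + ln (y - b)).
Proof.
move=> a0 ab bx xy.
have [xb xb' xa xa'] : [/\ 0 < x + b, 0 < x - b, 0 < x + a & 0 < x - a].
  by split; lra.
have [yb yb' ya ya'] : [/\ 0 < y + b, 0 < y - b, 0 < y + a & 0 < y - a].
  by split; lra.
rewrite -!lnM ?posrE ?mulr_gt0// ltr_ln ?posrE ?mulr_gt0// -subr_gt0.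
have -> : (x + a) * (x - a) * ((y + b) * (y - b)) -
  (x + b) * (x - b) * ((y + a) * (y - a)) =
  (b - a) * (b + a) * ((y - x) * (y + x)) by ring.
by apply: mulr_gt0; apply: mulr_gt0; lra.
Qed.

End log_inequalities.

(** * The Gamma function *)

Section Gamma.
Variable R : realType.
Implicit Types (x y t a b l m u v : R).
Notation mu := (@lebesgue_measure R).

Definition euler_integrand x t : R := t `^ (x - 1) * expR (- t).

Lemma euler_integrandE x t : 0 < t ->
  euler_integrand x t = expR ((x - 1) * ln t - t).
Proof. by move=> t0; rewrite /euler_integrand /powR gt_eqF// -expRD. Qed.

Lemma is_derive_euler_integrand x t : 0 < t ->
  is_derive t 1 (euler_integrand (x + 1))
    (x * euler_integrand x t - euler_integrand (x + 1) t).
Proof.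
move=> t0; have dp := is_derive1_powR x t0.
rewrite /euler_integrand addrK.
apply: is_derive_eq.
rewrite /GRing.scale/=; ring.
Qed.

Lemma continuous_euler_integrand x a b : 0 < a ->
  {within `[a, b], continuous (euler_integrand x)}.
Proof.
move=> a0; rewrite -(subrK 1 x); apply: derivable_within_continuous => t.
rewrite in_itv/= => /andP[at_ _].
exact: (@ex_derive _ _ _ _ _ _ _
  (is_derive_euler_integrand (x - 1) (lt_le_trans a0 at_))).
Qed.

Lemma integrable_euler_integrand x a b : 0 < a ->
  mu.-integrable `[a, b] (EFin \o euler_integrand x).
Proof.
move=> a0; apply: continuous_compact_integrable; first exact: segment_compact.
exact: continuous_euler_integrand.
Qed.

Lemma euler_integral_by_parts x a b : 0 < a -> a < b ->
  x * (\int[mu]_(t in `[a, b]) euler_integrand x t) =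
  \int[mu]_(t in `[a, b]) euler_integrand (x + 1) t +
  (euler_integrand (x + 1) b - euler_integrand (x + 1) a).
Proof.
move=> a0 ab.
have i1 := @integrable_euler_integrand x a b a0.
have i2 := @integrable_euler_integrand (x + 1) a b a0.
have i3 : mu.-integrable `[a, b] (EFin \o (fun t => x * euler_integrand x t)).
  exact: (@integrableZl _ _ _ mu _ (measurable_itv _) x _ i1).
apply/eqP; rewrite addrC -subr_eq -RintegralZl// -RintegralB//; apply/eqP.
rewrite /Rintegral.
rewrite (@continuous_FTC2 _ _ (euler_integrand (x + 1)) a b ab)//=.
- have -> : (fun t => x * euler_integrand x t - euler_integrand (x + 1) t) =
    (fun t => x * euler_integrand x t) \- euler_integrand (x + 1) by [].
  move=> t; apply: continuousB; last exact: continuous_euler_integrand.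
  apply: continuousM; first exact: cst_continuous.
  exact: continuous_euler_integrand.
- have := @continuous_euler_integrand (x + 1) a b a0.
  move=> /(continuous_within_itvP _ ab)[_ ca cb]; split => // t.
  rewrite in_itv/= => /andP[at_ _].
  by have [] := is_derive_euler_integrand x (lt_trans a0 at_).
- move=> t; rewrite in_itv/= => /andP[at_ _].
  have ? := is_derive_euler_integrand x (lt_trans a0 at_).
  by rewrite derive1E derive_val.
Qed.

(* The segments start at index 2 so that they are never degenerate. *)
Let segment (n : nat) := `[(n.+2%:R : R)^-1, n.+2%:R]%classic.

Definition truncated_Gamma x (n : nat) : R :=
  \int[mu]_(t in segment n) euler_integrand x t.

Let lo_gt0 (n : nat) : 0 < (n.+2%:R : R)^-1.
Proof. by rewrite invr_gt0 ltr0n. Qed.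

Let lo_lt1 (n : nat) : (n.+2%:R : R)^-1 < 1.
Proof. by rewrite invf_lt1 ?ltr0n// ltr1n. Qed.

Let lo_lt_hi (n : nat) : (n.+2%:R : R)^-1 < n.+2%:R.
Proof. by rewrite (lt_trans (lo_lt1 n))// ltr1n. Qed.

Let segment_gt0 n t : segment n t -> 0 < t.
Proof. by rewrite /segment/= in_itv/= => /andP[+ _]; apply: lt_le_trans. Qed.

Lemma truncated_Gamma_succ x n :
  x * truncated_Gamma x n = truncated_Gamma (x + 1) n +
  (euler_integrand (x + 1) n.+2%:R - euler_integrand (x + 1) (n.+2%:R)^-1).
Proof. exact: euler_integral_by_parts. Qed.

Lemma euler_integrand_ge0 x t : 0 <= euler_integrand x t.
Proof. by rewrite /euler_integrand mulr_ge0 ?powR_ge0 ?expR_ge0. Qed.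

Lemma euler_integrand_succ_le x t : 0 < x -> 0 < t ->
  euler_integrand (x + 1) t <= expR (x * ln (2 * x) - x) * expR (- (t / 2)).
Proof.
move=> x0 t0; rewrite euler_integrandE// addrK -expRD ler_expR.
have x2 : 0 < 2 * x by lra.
have /(ler_wpM2l (ltW x0)) := ln_le_tangent x2 t0.
have -> : x * (t / (2 * x) - 1 + ln (2 * x)) = t / 2 - x + x * ln (2 * x).
  by field; rewrite gt_eqF.
lra.
Qed.

Lemma euler_integrand_lo_le x n : 0 < x ->
  euler_integrand (x + 1) (n.+2%:R)^-1 <= expR (- (x * ln n.+2%:R)).
Proof.
move=> x0; rewrite euler_integrandE// addrK ler_expR lnV ?posrE ?ltr0n//.
by rewrite mulrN gerBl ltW.
Qed.

(** For natural arguments the bound follows by induction from integration by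
    parts. For x >= 1 the power t^(x-1) is dominated by 1 + t^k for a natural k,
    and for x > 0 integration by parts bounds the integral at x by the one at
    x + 1. *)
Lemma truncated_Gamma_bounded x : 0 < x ->
  exists M, forall n, truncated_Gamma x n <= M.
Proof.
have bnat (k : nat) : exists M, forall n, truncated_Gamma k.+1%:R n <= M.
  elim: k => [|k [M kM]].
    (* At x = 0 the recursion reads 0 = truncated_Gamma 1 n + boundary terms. *)
    exists 1 => n; have := truncated_Gamma_succ 0 n.
    rewrite mul0r add0r !euler_integrandE ?ltr0n//.
    rewrite subrr !mul0r !add0r => /eqP; rewrite eq_sym addr_eq0 => /eqP ->.
    have : expR (- (n.+2%:R)^-1) <= 1 :> R by rewrite expR_le1 oppr_le0 ltW.
    have := expR_ge0 (- (n.+2%:R : R)); lra.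
  exists (k.+1%:R * M + 1) => n; have := truncated_Gamma_succ k.+1%:R n.
  rewrite natr1 => h.
  have : k.+1%:R * truncated_Gamma k.+1%:R n <= k.+1%:R * M.
    by rewrite ler_wpM2l.
  have : euler_integrand k.+2%:R (n.+2%:R)^-1 <= 1.
    rewrite -natr1; apply: (le_trans (euler_integrand_lo_le _ _)) => //.
    by rewrite expR_le1 oppr_le0 mulr_ge0//; apply: ln_ge0; rewrite ler1n.
  have := euler_integrand_ge0 k.+2%:R n.+2%:R; lra.
have bge1 y : 1 <= y -> exists M, forall n, truncated_Gamma y n <= M.
  move=> y1; have [M1 hM1] := bnat 0%N.
  set k := Num.truncn y.
  have [Mk hMk] := bnat k.
  have yk : y < k.+1%:R by rewrite truncnS_gt.
  exists (M1 + Mk) => n; apply: le_trans (lerD (hM1 n) (hMk n)).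
  have iF z := @integrable_euler_integrand z _ (n.+2%:R) (lo_gt0 n).
  rewrite -RintegralD; [|exact: measurable_itv|exact: iF|exact: iF].
  apply: le_Rintegral; [exact: measurable_itv|exact: iF| |].
    exact: (@integrableD _ _ _ mu _ (measurable_itv _) _ _ (iF _) (iF _)).
  move=> t /segment_gt0 t0; rewrite !euler_integrandE//.
  have [t1|t1] := leP 1 t.
    rewrite -[leLHS]add0r; apply: lerD; rewrite ?expR_ge0// ler_expR.
    have := ln_ge0 t1; nra.
  rewrite -[leLHS]addr0; apply: lerD; rewrite ?expR_ge0// ler_expR.
  have := ln_le0 (ltW t1); nra.
move=> x0; have [|M hM] := bge1 (x + 1); first by lra.
exists ((M + expR (x * ln (2 * x) - x)) / x) => n.
rewrite ler_pdivlMr// mulrC truncated_Gamma_succ; apply: lerD (hM n) _.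
apply: (@le_trans _ _ (euler_integrand (x + 1) n.+2%:R)).
  by rewrite gerBl euler_integrand_ge0.
apply: (le_trans (euler_integrand_succ_le x0 _)); first by rewrite ltr0n.
by rewrite ler_piMr ?expR_ge0// expR_le1 oppr_le0 divr_ge0.
Qed.

Lemma bigcup_segment : \bigcup_n segment n = `]0, +oo[%classic.
Proof.
apply/seteqP; split => [t [n _ /segment_gt0 t0]|t].
  by rewrite /= in_itv/= t0.
rewrite /= in_itv/= andbT => t0.
exists (maxn (Num.truncn t) (Num.truncn t^-1)) => //.
rewrite /segment/= in_itv/=; apply/andP; split.
  rewrite invf_ple ?posrE ?ltr0n//.
  apply: (le_trans (ltW (truncnS_gt _))).
  by rewrite ler_nat ltnS leqW// leq_maxr.
apply: (le_trans (ltW (truncnS_gt _))).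
by rewrite ler_nat ltnS leqW// leq_maxl.
Qed.

(** Boundedness is what makes Euler's integral finite, so that its real-valued
    version is the limit and not a default value. *)
Lemma cvg_truncated_Gamma x : 0 < x ->
  truncated_Gamma x n @[n --> \oo] --> Gamma x.
Proof.
move=> x0; have [M hM] := truncated_Gamma_bounded x0.
have mF n : measurable (segment n : set (measurableTypeR R)).
  exact: measurable_itv.
have iF n := @integrable_euler_integrand x _ (n.+2%:R) (lo_gt0 n).
have nF : nondecreasing_seq segment.
  move=> m n mn; rewrite subsetEset => t.
  rewrite /segment/= !in_itv/= => /andP[h1 h2].
  apply/andP; split.
    by apply: le_trans h1; rewrite lef_pV2 ?posrE ?ltr0n// ler_nat.
  by apply: (le_trans h2); rewrite ler_nat.
have := @ge0_nondecreasing_set_cvg_integral _ (measurableTypeR R) R segment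
  (EFin \o euler_integrand x) mu nF mF
  (fun n => measurable_int _ (iF n))
  (fun n t _ => euler_integrand_ge0 x t).
rewrite bigcup_segment => cv.
have E n : (\int[mu]_(t in segment n) (EFin \o euler_integrand x) t =
    (truncated_Gamma x n)%:E)%E.
  rewrite /truncated_Gamma /Rintegral fineK//.
  exact: integrable_fin_num (iF n).
move: cv; under eq_cvg do rewrite E.
move=> cv.
have lM : (\int[mu]_(t in `]0%R, +oo[) (EFin \o euler_integrand x) t <= M%:E)%E.
  by apply: (cvge_to_le cv); apply: nearW => n /=; rewrite lee_fin.
have fin : (\int[mu]_(t in `]0%R, +oo[) (EFin \o euler_integrand x) t)%E
    \is a fin_num.
  rewrite ge0_fin_numE; first by rewrite (le_lt_trans lM)// ltry.
  by apply: integral_ge0 => t _; rewrite lee_fin euler_integrand_ge0.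
rewrite -(fineK fin) in cv.
exact: (fine_cvg cv).
Qed.

Lemma cvg_euler_integrand_hi x : 0 < x ->
  euler_integrand (x + 1) n.+2%:R @[n --> \oo] --> (0 : R).
Proof.
move=> x0.
have c : expR (x * ln (2 * x) - x) * expR (- (n.+2%:R / 2)) @[n --> \oo] -->
    (0 : R).
  rewrite -[X in _ --> X](mulr0 (expR (x * ln (2 * x) - x))).
  apply: cvgMr.
  apply: (cvg_comp (fun n : nat => n.+2%:R / 2) (fun t : R => expR (- t)) _
    (@cvgr_expR R)).
  apply/cvgryPge => A; near=> n.
  rewrite ler_pdivlMr//; apply: (@le_trans _ _ n%:R).
    by near: n; exact: nbhs_infty_ger.
  by rewrite ler_nat -addn2 leq_addr.
apply: (squeeze_cvgr _ (cvg_cst 0) c); apply: nearW => n.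
by rewrite euler_integrand_ge0 euler_integrand_succ_le ?ltr0n.
Unshelve. all: by end_near. Qed.

Lemma cvg_euler_integrand_lo x : 0 < x ->
  euler_integrand (x + 1) (n.+2%:R)^-1 @[n --> \oo] --> (0 : R).
Proof.
move=> x0.
have c : expR (- (x * ln (n.+2%:R : R))) @[n --> \oo] --> (0 : R).
  apply: (cvg_comp (fun n : nat => x * ln (n.+2%:R : R))
    (fun t : R => expR (- t)) _ (@cvgr_expR R)).
  apply/cvgryPge => A; near=> n.
  rewrite -ler_pdivrMl// -ler_expR lnK ?posrE ?ltr0n//.
  apply: (@le_trans _ _ n%:R).
    by near: n; exact: nbhs_infty_ger.
  by rewrite ler_nat -addn2 leq_addr.
apply: (squeeze_cvgr _ (cvg_cst 0) c); apply: nearW => n.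
by rewrite euler_integrand_ge0 euler_integrand_lo_le.
Unshelve. all: by end_near. Qed.

Lemma Gamma_succ x : 0 < x -> Gamma (x + 1) = x * Gamma x.
Proof.
move=> x0.
have c1 : x * truncated_Gamma x n @[n --> \oo] --> x * Gamma x.
  by apply: cvgMr; exact: cvg_truncated_Gamma.
have c2 : truncated_Gamma (x + 1) n + (euler_integrand (x + 1) n.+2%:R -
    euler_integrand (x + 1) (n.+2%:R)^-1) @[n --> \oo] -->
    Gamma (x + 1) + (0 - 0).
  apply: cvgD; first by apply: cvg_truncated_Gamma; lra.
  by apply: cvgB; [exact: cvg_euler_integrand_hi|exact: cvg_euler_integrand_lo].
move: c1; under eq_cvg do rewrite truncated_Gamma_succ.
by move=> /(cvg_unique _ c2) <-//; rewrite subrr addr0.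
Qed.

Lemma Gamma_ge_truncated x n : 0 < x -> truncated_Gamma x n <= Gamma x.
Proof.
move=> x0; apply: (cvgr_to_ge (cvg_truncated_Gamma x0)).
exists n => // m /= nm.
have i := @integrable_euler_integrand x _ (m.+2%:R) (lo_gt0 m).
rewrite /truncated_Gamma /Rintegral; apply: fine_le.
- exact: integrable_fin_num
    (@integrable_euler_integrand x _ (n.+2%:R) (lo_gt0 n)).
- exact: integrable_fin_num i.
- apply: ge0_subset_integral.
  + exact: measurable_itv.
  + exact: measurable_itv.
  + exact: measurable_int i.
  + by move=> t _; rewrite lee_fin euler_integrand_ge0.
  + move=> t; rewrite /segment/= !in_itv/= => /andP[h1 h2]; apply/andP; split.
      by apply: le_trans h1; rewrite lef_pV2 ?posrE ?ltr0n// ler_nat.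
    by apply: (le_trans h2); rewrite ler_nat.
Qed.

Lemma Gamma_gt0 x : 0 < x -> 0 < Gamma x.
Proof.
move=> x0; apply: lt_le_trans (Gamma_ge_truncated 0 x0).
set m := expR (- (`|x - 1| + 2)).
have h : \int[mu]_(t in segment 0) m = m * (2 - 2^-1).
  rewrite Rintegral_cst; last exact: measurable_itv.
  congr (m * _); apply: (etrans (congr1 fine (lebesgue_measure_itv _))).
  by rewrite /= lte_fin (lt_trans (lo_lt1 0))// ltr1n.
apply: (@lt_le_trans _ _ (m * (2 - 2^-1))).
  by rewrite mulr_gt0 ?expR_gt0//; lra.
rewrite -h; apply: le_Rintegral.
- exact: measurable_itv.
- apply: continuous_compact_integrable; first exact: segment_compact.
  exact: cst_continuous.
- exact: integrable_euler_integrand.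
- move=> t Ft; have t0 := segment_gt0 Ft.
  move: Ft; rewrite /segment/= in_itv/= => /andP[t1 t2].
  rewrite euler_integrandE// ler_expR.
  have l1 : ln t <= 1.
    by have := @ln_le_tangent R 1 t ltr01 t0; rewrite ln1; lra.
  have l2 : - 1 <= ln t.
    have ti : 0 < t^-1 by rewrite invr_gt0.
    have := @ln_le_tangent R 1 t^-1 ltr01 ti; rewrite ln1 lnV ?posrE//.
    have : t^-1 <= 2 by rewrite invf_ple ?posrE.
    lra.
  by case: (ler0P (x - 1)) => x1; nra.
Qed.

(** Hoelder's inequality in the form obtained from the pointwise convexity of
    exp. The free parameters u and v stand for the logarithms of the two
    integrals on the right. They are kept free because the lemma will be used
    with the logarithms of the limits. *)
Lemma truncated_Gamma_log_convex x y u v l m n :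
  0 <= l -> 0 <= m -> l + m = 1 ->
  truncated_Gamma (l * x + m * y) n <= expR (l * u + m * v) *
    (l * (expR (- u) * truncated_Gamma x n) +
     m * (expR (- v) * truncated_Gamma y n)).
Proof.
move=> l0 m0 lm.
have iF z := @integrable_euler_integrand z _ (n.+2%:R) (lo_gt0 n).
have iZ c z :
  mu.-integrable (segment n) (EFin \o (fun t => c * euler_integrand z t)).
  exact: (@integrableZl _ _ _ mu _ (measurable_itv _) _ _ (iF _)).
set E := expR (l * u + m * v).
have -> : E * (l * (expR (- u) * truncated_Gamma x n) +
      m * (expR (- v) * truncated_Gamma y n)) =
    \int[mu]_(t in segment n) ((E * l * expR (- u)) * euler_integrand x t +
       (E * m * expR (- v)) * euler_integrand y t).
  rewrite RintegralD; [|exact: measurable_itv|exact: iZ|exact: iZ].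
  rewrite !RintegralZl; [|exact: measurable_itv|exact: iF|
    exact: measurable_itv|exact: iF].
  by rewrite /truncated_Gamma; ring.
apply: le_Rintegral; [exact: measurable_itv|exact: iF| |].
  exact: (@integrableD _ _ _ mu _ (measurable_itv _) _ _ (iZ _ _) (iZ _ _)).
move=> t /segment_gt0 t0; rewrite !euler_integrandE//.
set A := (x - 1) * ln t - t - u; set B := (y - 1) * ln t - t - v.
have -> : E * l * expR (- u) * expR ((x - 1) * ln t - t) = E * l * expR A.
  by rewrite -mulrA -expRD addrC.
have -> : E * m * expR (- v) * expR ((y - 1) * ln t - t) = E * m * expR B.
  by rewrite -mulrA -expRD addrC.
have -> : (l * x + m * y - 1) * ln t - t = (l * u + m * v) + (l * A + m * B).
  rewrite /A /B; have -> : m = 1 - l by lra.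
  ring.
rewrite expRD -/E -!mulrA -mulrDr ler_pM2l ?expR_gt0//.
set M := l * A + m * B.
(* exp lies above its tangent at M, the weighted mean of A and B. *)
have tangent C : expR M * (1 + (C - M)) <= expR C.
  have -> : expR C = expR M * expR (C - M) by rewrite -expRD addrC subrK.
  by rewrite ler_pM2l ?expR_gt0// expR_ge1Dx.
have e : l * (expR M * (1 + (A - M))) + m * (expR M * (1 + (B - M))) = expR M.
  transitivity (expR M * ((l + m) * (1 - M) + (l * A + m * B))); first by ring.
  by rewrite lm -/M; ring.
by rewrite -[leLHS]e; apply: lerD; apply: ler_wpM2l.
Qed.

Lemma expR_lnGamma x : 0 < x -> expR (lnGamma x) = Gamma x.
Proof. by move=> x0; apply: lnK; rewrite posrE; exact: Gamma_gt0. Qed.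

Lemma lnGamma_convex x y l m :
  0 < x -> 0 < y -> 0 <= l -> 0 <= m -> l + m = 1 ->
  lnGamma (l * x + m * y) <= l * lnGamma x + m * lnGamma y.
Proof.
move=> x0 y0 l0 m0 lm.
have z0 : 0 < l * x + m * y.
  have [l1|l1] := eqVneq l 0.
    by move: lm; rewrite l1 add0r mul0r add0r => ->; rewrite mul1r.
  apply: ltr_wpDr; first by rewrite mulr_ge0// ltW.
  by rewrite mulr_gt0// lt0r l1.
rewrite -ler_expR (expR_lnGamma z0).
apply: (cvgr_to_le (cvg_truncated_Gamma z0)); apply: nearW => n.
have := truncated_Gamma_log_convex x y (lnGamma x) (lnGamma y) n l0 m0 lm.
move=> /le_trans; apply.
have h z : 0 < z -> expR (- lnGamma z) * truncated_Gamma z n <= 1.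
  move=> z_gt0; rewrite expRN (expR_lnGamma z_gt0) mulrC.
  by rewrite ler_pdivrMr ?mul1r ?Gamma_ge_truncated// Gamma_gt0.
apply: ler_piMr; first exact: expR_ge0.
by rewrite -lm; apply: lerD; apply: ler_piMr => //; exact: h.
Qed.

Lemma lnGamma_succ x : 0 < x -> lnGamma (x + 1) = lnGamma x + ln x.
Proof.
by move=> x0; rewrite /lnGamma Gamma_succ// lnM ?posrE ?Gamma_gt0// addrC.
Qed.
End Gamma.

(** * Convex solutions of the functional equation *)

Section convex_solution.
Variable R : realType.
Implicit Types (x y a b r p q k rho l m : R).
(* The argument uses only these two properties of L = ln Gamma. *)
Variable L : R -> R.
Hypothesis L_succ : forall x, 0 < x -> L (x + 1) = L x + ln x.
Hypothesis L_convex : forall x y l m, 0 < x -> 0 < y -> 0 <= l -> 0 <= m ->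
  l + m = 1 -> L (l * x + m * y) <= l * L x + m * L y.

Lemma chord_le u v w : 0 < u -> u < v -> v < w ->
  (w - u) * L v <= (w - v) * L u + (v - u) * L w.
Proof.
move=> u0 uv vw; have wu : 0 < w - u by lra.
have wu0 : w - u != 0 by rewrite gt_eqF.
have := @L_convex u w ((w - v) / (w - u)) ((v - u) / (w - u)) u0.
have -> : (w - v) / (w - u) * u + (v - u) / (w - u) * w = v by field.
move=> /(_ _ _ _ _)/(ler_wpM2l (ltW wu)) h.
have -> : (w - v) * L u + (v - u) * L w =
  (w - u) * ((w - v) / (w - u) * L u + (v - u) / (w - u) * L w) by field.
apply: h; [lra|by rewrite divr_ge0//; lra|by rewrite divr_ge0//; lra|by field].
Qed.

Lemma increment_ge y a : 1 < y -> 0 <= a -> a * ln (y - 1) <= L (y + a) - L y.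
Proof.
move=> y1; rewrite le_eqVlt => /predU1P[<-|a0].
  by rewrite addr0 subrr mul0r.
have := @chord_le (y - 1) y (y + a); have := @L_succ (y - 1).
rewrite subrK => -> ; last by lra.
move=> /(_ _ _ _) h; have {h} : (y + a - (y - 1)) * (L (y - 1) + ln (y - 1)) <=
  (y + a - y) * L (y - 1) + (y - (y - 1)) * L (y + a) by apply: h; lra.
lra.
Qed.

Lemma increment_le y a : 0 < y -> 0 <= a -> L (y + a) - L y <= a * ln (y + a).
Proof.
move=> y0; rewrite le_eqVlt => /predU1P[<-|a0].
  by rewrite addr0 subrr mul0r.
have := @chord_le y (y + a) (y + a + 1); rewrite L_succ; last by lra.
move=> /(_ _ _ _) h; have {h} : (y + a + 1 - y) * L (y + a) <=
  (y + a + 1 - (y + a)) * L y + (y + a - y) * (L (y + a) + ln (y + a)).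
  by apply: h; lra.
lra.
Qed.

(** Convexity squeezes L (y + a) - L y between slopes over unit intervals, and
    those are values of ln by the functional equation. *)
Lemma increment_asymptotics y a : 1 + `|a| < y ->
  `|L (y + a) - L y - a * ln y| <= `|a| * (ln (y + `|a|) - ln (y - 1 - `|a|)).
Proof.
have mono b c : 0 < b -> b <= c -> ln b <= ln c :> R.
  by move=> b0 bc; rewrite ler_ln ?posrE//; lra.
rewrite ler_norml.
have [a0|a0] := ger0P a => ya.
  have l1 : ln (y - 1 - a) <= ln (y - 1) by apply: mono; lra.
  have l2 : ln (y - 1) <= ln y by apply: mono; lra.
  have l3 : ln y <= ln (y + a) by apply: mono; lra.
  have := @increment_ge y a; have := @increment_le y a.
  move=> /(_ _ _)h1 /(_ _ _)h2.
  have {}h1 : L (y + a) - L y <= a * ln (y + a) by apply: h1; lra.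
  have {}h2 : a * ln (y - 1) <= L (y + a) - L y by apply: h2; lra.
  apply/andP; split; nra.
have l1 : ln (y - 1 - - a) <= ln (y + a) by apply: mono; lra.
have l2 : ln (y + a) <= ln y by apply: mono; lra.
have l3 : ln y <= ln (y - a) by apply: mono; lra.
have := @increment_ge (y + a) (- a); have := @increment_le (y + a) (- a).
rewrite addrK.
move=> /(_ _ _)h1 /(_ _ _)h2.
have {}h1 : L y - L (y + a) <= - a * ln y by apply: h1; lra.
have {}h2 : - a * ln (y + a - 1) <= L y - L (y + a) by apply: h2; lra.
have e : y + a - 1 = y - 1 - - a by ring.
rewrite e in h2.
apply/andP; split; nra.
Qed.

Lemma cvg_increment x a :
  L (x + N%:R + a) - L (x + N%:R) - a * ln (x + N%:R) @[N --> \oo] --> (0 : R).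
Proof.
have c := @cvg_inv_shift R (`|a| * (2 * `|a| + 1)) (x - 1 - `|a|).
have cN : - (`|a| * (2 * `|a| + 1) / (x - 1 - `|a| + N%:R)) @[N --> \oo] -->
    (0 : R).
  by rewrite -[X in _ --> X]oppr0; apply: cvgN.
apply: (squeeze_cvgr _ cN c).
near=> N; rewrite -ler_norml.
have xN : 1 + `|a| < x + N%:R.
  rewrite -ltrBlDl; near: N; exact: nbhs_infty_gtr.
apply: (le_trans (increment_asymptotics xN)).
rewrite -mulrA ler_wpM2l//.
have a0 := normr_ge0 a.
have d0 : 0 < x + N%:R - 1 - `|a| by lra.
have -> : x - 1 - `|a| + N%:R = x + N%:R - 1 - `|a| by ring.
have /(ln_le_tangent d0) : 0 < x + N%:R + `|a| by lra.
have -> : (x + N%:R + `|a|) / (x + N%:R - 1 - `|a|) =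
  (2 * `|a| + 1) / (x + N%:R - 1 - `|a|) + 1 by field; rewrite gt_eqF.
lra.
Unshelve. all: by end_near. Qed.

(** The increment bounds need y > 1; below that, L w = L (w + 1) - ln w carries
    the continuity at y + 1 back to y. *)
Lemma continuous_L y : 0 < y -> {for y, continuous L}.
Proof.
have gt1 z : 1 < z -> {for z, continuous L}.
  move=> z1; set d := (z - 1) / 2; have d0 : 0 < d by rewrite divr_gt0//; lra.
  set M := `|ln z| + (ln (z + d) - ln (z - 1 - d)).
  have mono b c : 0 < b -> b <= c -> ln b <= ln c :> R.
    by move=> b0 bc; rewrite ler_ln ?posrE//; lra.
  have dz : z - 1 = 2 * d by rewrite /d; field.
  have M0 : 0 <= M.
    have : ln (z - 1 - d) <= ln (z + d) by apply: mono; lra.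
    have := normr_ge0 (ln z); rewrite /M; lra.
  have near_z w : `|z - w| < d -> `|L z - L w| <= M * `|z - w|.
    move=> wd; rewrite distrC [in leRHS]distrC; rewrite distrC in wd.
    have := @increment_asymptotics z (w - z); rewrite subrKC => /(_ _) h.
    have {}h : `|L w - L z - (w - z) * ln z| <=
      `|w - z| * (ln (z + `|w - z|) - ln (z - 1 - `|w - z|)) by apply: h; lra.
    have l1 : ln (z + `|w - z|) <= ln (z + d).
      by apply: mono; have := normr_ge0 (w - z); lra.
    have l2 : ln (z - 1 - d) <= ln (z - 1 - `|w - z|) by apply: mono; lra.
    have -> : L w - L z = (L w - L z - (w - z) * ln z) + (w - z) * ln z by ring.
    apply: (le_trans (ler_normD _ _)); rewrite [X in _ + X]normrM.
    have := normr_ge0 (w - z); rewrite /M; nra.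
  apply/cvgrPdist_lt => e e0; near=> w.
  have wd : `|z - w| < d by near: w; exact: cvgr_dist_lt.
  apply: (le_lt_trans (near_z _ wd)).
  apply: (@le_lt_trans _ _ ((M + 1) * `|z - w|)).
    by rewrite ler_wpM2r// lerDl.
  rewrite -ltr_pdivlMl; last by lra.
  near: w; apply: cvgr_dist_lt => //; rewrite mulr_gt0// invr_gt0; lra.
move=> y0.
have e : \forall w \near y, L (w + 1) - ln w = L w.
  near=> w; have w0 : 0 < w by near: w; exact: lt_nbhsr.
  by rewrite L_succ// addrK.
rewrite /prop_for /continuous_at.
apply: cvg_trans (near_eq_cvg e) _.
rewrite -(addrK (ln y) (L y)) -L_succ//.
apply: cvgB; last exact: continuous_ln.
apply: (cvg_comp (fun w => w + 1) L); last by apply: gt1; lra.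
by apply: cvgD; [exact: cvg_id|exact: cvg_cst].
Unshelve. all: by end_near. Qed.


(** * Comparison of spreads *)

Definition spread x r := L (x + 1 / 2 + r) + L (x + 1 / 2 - r) - 2 * L x.

Lemma spread_succ x r : 0 < x -> `|r| < x + 1 / 2 ->
  spread (x + 1) r - spread x r =
  ln (x + 1 / 2 + r) + ln (x + 1 / 2 - r) - 2 * ln x.
Proof.
move=> x0; rewrite ltr_norml => /andP[r1 r2].
rewrite /spread L_succ//.
have -> : x + 1 + 1 / 2 + r = x + 1 / 2 + r + 1 by ring.
have -> : x + 1 + 1 / 2 - r = x + 1 / 2 - r + 1 by ring.
rewrite !L_succ; [ring|lra|lra].
Qed.

Lemma spread_half x : 0 < x -> spread x (1 / 2) = ln x.
Proof.
move=> x0; rewrite /spread addrK.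
have -> : x + 1 / 2 + 1 / 2 = x + 1 by field.
by rewrite L_succ//; ring.
Qed.

Lemma cvg_spread x r :
  spread (x + N%:R) r - ln (x + N%:R) @[N --> \oo] --> (0 : R).
Proof.
pose d a (N : nat) := L (x + N%:R + a) - L (x + N%:R) - a * ln (x + N%:R).
have -> : (fun N : nat => spread (x + N%:R) r - ln (x + N%:R)) =
    d (1 / 2 + r) \+ d (1 / 2 - r).
  by apply/funext => N; rewrite /d /= /spread !addrA; field.
by rewrite -[X in _ --> X]addr0; apply: cvgD; exact: cvg_increment.
Qed.

(** The spread behaves like ln x at infinity. The term k / x is free and is
    chosen so that the increments under x -> x + 1 become monotone in x. *)
Definition corrected_spread k r x := spread x r - ln x - k / x.

Lemma cvg_corrected_spread k r x :
  corrected_spread k r (x + N%:R) @[N --> \oo] --> (0 : R).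
Proof.
rewrite -[X in _ --> X](subr0 0).
exact: cvgB (@cvg_spread x r) (@cvg_inv_shift R k x).
Qed.

Definition correction k rho x :=
  ln (1 - rho / (x * (x + 1))) + k / (x * (x + 1)).

(** The factor (x + 1/2)^2 - r^2 equals x * (x + 1) - (r^2 - 1/4), which is why
    r^2 - 1/4 is the natural parameter. *)
Lemma corrected_spread_succ k r x : 0 < x -> `|r| < x + 1 / 2 ->
  corrected_spread k r (x + 1) =
  corrected_spread k r x + correction k (r ^+ 2 - 1 / 4) x.
Proof.
move=> x0 rx; have := spread_succ x0 rx.
move: rx; rewrite ltr_norml => /andP[r1 r2].
rewrite /corrected_spread /correction -lnM ?posrE; [|lra|lra].
set S1 := spread _ _; set S0 := spread _ _.
have x1 : 0 < x + 1 by lra.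
have -> : 1 - (r ^+ 2 - 1 / 4) / (x * (x + 1)) =
  (x + 1 / 2 + r) * (x + 1 / 2 - r) / (x * (x + 1)) by field; rewrite !gt_eqF.
rewrite ln_div ?posrE ?mulr_gt0//; [|lra|lra].
rewrite (lnM (x := x)) ?posrE//.
have -> : k / (x + 1) = k / x - k / (x * (x + 1)) by field; rewrite !gt_eqF.
lra.
Qed.

(** The differences between p + N and q + N are nondecreasing in N and tend
    to 0, so the first of them is at most 0. *)
Lemma corrected_spread_le k r p q : 0 < q -> 0 < p -> `|r| < q + 1 / 2 ->
  `|r| < p + 1 / 2 ->
  (forall N : nat, correction k (r ^+ 2 - 1 / 4) (q + N%:R) <=
     correction k (r ^+ 2 - 1 / 4) (p + N%:R)) ->
  corrected_spread k r p <= corrected_spread k r q.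
Proof.
move=> q0 p0 rq rp h.
pose u (N : nat) :=
  corrected_spread k r (p + N%:R) - corrected_spread k r (q + N%:R).
suff : u 0%N <= 0 by rewrite /u !addr0 subr_le0.
apply: nondecreasing_cvg0_le0 => [N|].
  have N0 : 0 <= N%:R :> R by [].
  rewrite /u -natr1 !addrA !corrected_spread_succ; try lra.
  have := h N; lra.
rewrite -[X in _ --> X](subr0 0).
by apply: cvgB; exact: cvg_corrected_spread.
Qed.

(** The choice k = rho makes the corrections increase with x, and
    ln p - ln q <= p / q - 1. *)
Lemma spread_diff_upper p q r : 0 < q -> q < p -> 1 / 2 <= r -> r < q + 1 / 2 ->
  spread p r - spread q r <= (p - q) * (p - (r ^+ 2 - 1 / 4)) / (p * q).
Proof.
move=> q0 qp r12 rq; set rho := r ^+ 2 - 1 / 4.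
have p0 : 0 < p by lra.
have rn : `|r| = r by rewrite ger0_norm; lra.
have rho0 : 0 <= rho by rewrite /rho; nra.
have : corrected_spread rho r p <= corrected_spread rho r q.
  apply: corrected_spread_le => //; try (rewrite rn; lra).
  move=> N; rewrite -/rho /correction.
  have N0 : 0 <= N%:R :> R by [].
  have qN : 0 < q + N%:R by lra.
  have pN : q + N%:R <= p + N%:R by lra.
  apply: ln_sub_add_le => //.
  - by rewrite invr_ge0; apply: mulr_ge0; lra.
  - exact: pronic_inv_le.
  - rewrite ltr_pdivrMr ?mul1r; [rewrite /rho; nra|apply: mulr_gt0; lra].
have /(ln_le_tangent q0) : 0 < p by [].
rewrite /corrected_spread.
have -> : (p - q) * (p - rho) / (p * q) = p / q - 1 + (rho / p - rho / q).
  by field; rewrite !gt_eqF.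
lra.
Qed.

(** The choice k = rho + 1 makes the corrections decrease with x >= rho, and
    ln p - ln q >= 1 - q / p. *)
Lemma spread_diff_lower p q r : 0 < q -> q < p -> 1 / 2 <= r ->
  r ^+ 2 - 1 / 4 <= q ->
  (p - q) * (q - (r ^+ 2 - 1 / 4) - 1) / (p * q) <= spread p r - spread q r.
Proof.
move=> q0 qp r12; set rho := r ^+ 2 - 1 / 4 => rhoq.
have p0 : 0 < p by lra.
have rn : `|r| = r by rewrite ger0_norm; lra.
have rq : r < q + 1 / 2 by move: rhoq; rewrite /rho; nra.
have rho0 : 0 <= rho by rewrite /rho; nra.
have : corrected_spread (rho + 1) r q <= corrected_spread (rho + 1) r p.
  apply: corrected_spread_le => //; try (rewrite rn; lra).
  move=> N; rewrite -/rho /correction.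
  have N0 : 0 <= N%:R :> R by [].
  have qN : 0 < q + N%:R by lra.
  have pN : q + N%:R <= p + N%:R by lra.
  apply: ln_sub_add_ge => //.
  - by rewrite invr_ge0; apply: mulr_ge0; lra.
  - exact: pronic_inv_le.
  - rewrite ler_pdivrMr ?mul1r; [nra|apply: mulr_gt0; lra].
have /(ln_le_tangent p0) : 0 < q by [].
rewrite /corrected_spread.
have -> : (p - q) * (q - rho - 1) / (p * q) =
    1 - q / p - ((rho + 1) / q - (rho + 1) / p).
  by field; rewrite !gt_eqF.
lra.
Qed.

(** The differences between the values at b and at a increase strictly along
    q + N, p + N, and they tend to 0. *)
Lemma spread_diff_decreasing p q a b : 0 < q -> q < p ->
  0 <= a -> a < b -> b < q + 1 / 2 ->
  spread p b - spread q b < spread p a - spread q a.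
Proof.
move=> q0 qp a0 ab bq.
pose u (N : nat) := (spread (p + N%:R) b - spread (q + N%:R) b) -
  (spread (p + N%:R) a - spread (q + N%:R) a).
have uS N : u N < u N.+1.
  have N0 : 0 <= N%:R :> R by [].
  have := @spread_succ (p + N%:R) b; have := @spread_succ (p + N%:R) a.
  have := @spread_succ (q + N%:R) b; have := @spread_succ (q + N%:R) a.
  rewrite !ger0_norm; [|lra|lra].
  move=> /(_ _ _)h1 /(_ _ _)h2 /(_ _ _)h3 /(_ _ _)h4.
  have {}h1 := h1 ltac:(lra) ltac:(lra).
  have {}h2 := h2 ltac:(lra) ltac:(lra).
  have {}h3 := h3 ltac:(lra) ltac:(lra).
  have {}h4 := h4 ltac:(lra) ltac:(lra).
  rewrite /u -natr1 !addrA.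
  have := @ln_sub_sqr_cross R a b (q + N%:R + 1 / 2) (p + N%:R + 1 / 2).
  move=> /(_ a0 ab) h5; have {}h5 := h5 ltac:(lra) ltac:(lra).
  lra.
have u1 : u 1%N <= 0.
  apply: nondecreasing_cvg0_le0 => [N|]; first exact: ltW.
  have cs k r : corrected_spread 0 r (k + N%:R) @[N --> \oo] --> (0 : R).
    exact: cvg_corrected_spread.
  have -> : u = fun N : nat => (corrected_spread 0 b (p + N%:R) -
     corrected_spread 0 b (q + N%:R)) - (corrected_spread 0 a (p + N%:R) -
     corrected_spread 0 a (q + N%:R)).
    by apply/funext => N; rewrite /u /corrected_spread; ring.
  rewrite -[X in _ --> X](subr0 0).
  rewrite -[X in X - _](subr0 0) -[X in _ - X](subr0 0).
  by apply: cvgB; apply: cvgB; exact: cs.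
have := lt_le_trans (uS 0%N) u1.
by rewrite /u !addr0 subr_lt0.
Qed.

(** One step of the recursion isolates ln (q + 1/2 - r), which tends to minus
    infinity as r tends to q + 1/2; the remaining terms are bounded above. *)
Lemma spread_diff_le0 p q : 0 < q -> q < p ->
  exists2 r, 1 / 2 <= r < q + 1 / 2 & spread p r - spread q r <= 0.
Proof.
move=> q0 qp.
(* M bounds the remaining terms, and eps is the value of q + 1/2 - r. *)
pose M := (ln (p + 1) - ln (q + 1)) - ln (p + 1) - ln (p - q) + 2 * ln p +
  ln (2 * q + 1) - 2 * ln q.
pose eps := Num.min q (expR (- M)).
have eps0 : 0 < eps by rewrite lt_min q0 expR_gt0.
have epsq : eps <= q by rewrite ge_min lexx.
have epsM : ln eps <= - M.
  by rewrite -ler_expR lnK ?posrE// ge_min lexx orbT.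
exists (q + 1 / 2 - eps); first by apply/andP; split; lra.
set r := q + 1 / 2 - eps.
have r1 : 1 / 2 <= r by rewrite /r; lra.
have rq : r < q + 1 / 2 by rewrite /r; lra.
have := @spread_succ p r; have := @spread_succ q r.
rewrite ger0_norm; last by lra.
move=> /(_ _ _)h1 /(_ _ _)h2.
have {}h1 := h1 ltac:(lra) ltac:(lra).
have {}h2 := h2 ltac:(lra) ltac:(lra).
have e : q + 1 / 2 - r = eps by rewrite /r; ring.
rewrite e in h1.
have h3 : spread (p + 1) r - spread (q + 1) r <= ln (p + 1) - ln (q + 1).
  rewrite -!spread_half; try lra.
  move: r1; rewrite le_eqVlt => /predU1P[<-//|r1].
  by apply/ltW/spread_diff_decreasing; lra.
have mono b c : 0 < b -> b <= c -> ln b <= ln c :> R.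
  by move=> b0 bc; rewrite ler_ln ?posrE//; lra.
have l1 : ln (p + 1) <= ln (p + 1 / 2 + r) by apply: mono; lra.
have l2 : ln (p - q) <= ln (p + 1 / 2 - r) by apply: mono; lra.
have l3 : ln (q + 1 / 2 + r) <= ln (2 * q + 1) by apply: mono; lra.
move: epsM; rewrite /M; lra.
Qed.

Lemma continuous_spread x r :
  `|r| < x + 1 / 2 -> {for r, continuous (spread x)}.
Proof.
rewrite ltr_norml => /andP[r1 r2]; rewrite /spread.
apply: cvgB; last exact: cvg_cst.
apply: cvgD.
  apply: (cvg_comp (fun r => x + 1 / 2 + r) L); last by apply: continuous_L; lra.
  by apply: cvgD; [exact: cvg_cst|exact: cvg_id].
apply: (cvg_comp (fun r => x + 1 / 2 - r) L); last by apply: continuous_L; lra.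
by apply: cvgB; [exact: cvg_cst|exact: cvg_id].
Qed.

Lemma spread_diff_root p q : 0 < q -> q < p ->
  exists2 r, 1 / 2 < r < q + 1 / 2 & spread p r - spread q r = 0.
Proof.
move=> q0 qp; have [r /andP[r1 rq] fr] := spread_diff_le0 q0 qp.
have f12 : 0 < spread p (1 / 2) - spread q (1 / 2).
  by rewrite !spread_half//; [rewrite subr_gt0 ltr_ln ?posrE//|]; lra.
have [||c] := @IVT R (fun r => spread p r - spread q r) (1 / 2) r 0 r1.
- apply/continuous_in_subspaceT => t; rewrite inE/= in_itv/= => /andP[t1 t2].
  by apply: cvgB; apply: continuous_spread; rewrite ger0_norm; lra.
- by rewrite ge_min fr orbT le_max ltW.
rewrite in_itv/= => /andP[c1 c2] fc; exists c => //.
apply/andP; split; last by lra.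
rewrite lt_neqAle c1 andbT; apply/eqP => ec; move: fc f12; rewrite ec => ->.
by rewrite ltxx.
Qed.

Lemma spread_diff_lt0 p q r : 0 < q -> q < p -> 1 / 2 <= r -> r < q + 1 / 2 ->
  p < r ^+ 2 - 1 / 4 -> spread p r - spread q r < 0.
Proof.
move=> q0 qp r12 rq pr; apply: le_lt_trans (spread_diff_upper q0 qp r12 rq) _.
rewrite pmulr_llt0; last by rewrite invr_gt0 mulr_gt0//; lra.
by rewrite pmulr_rlt0; lra.
Qed.

Lemma spread_diff_gt0 p q r : 0 < q -> q < p -> 1 / 2 <= r ->
  r ^+ 2 - 1 / 4 < q - 1 -> 0 < spread p r - spread q r.
Proof.
move=> q0 qp r12 rq; have rq' : r ^+ 2 - 1 / 4 <= q by lra.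
apply: lt_le_trans (spread_diff_lower q0 qp r12 rq').
apply: divr_gt0; last by rewrite mulr_gt0//; lra.
by apply: mulr_gt0; lra.
Qed.

End convex_solution.

(** * The threshold polynomials *)

Section threshold_polynomials.
Variable R : realType.
Implicit Types (s e x y t z : R) (p : {poly R}).

(** The largest root is the supremum of the points where p is nonpositive. *)
Lemma largest_root_exists p a : p.[a] <= 0 -> p.[x] @[x --> +oo] --> +oo ->
  exists x, largest_root p x /\ forall y, x < y -> 0 < p.[y].
Proof.
move=> pa /cvgryPgt/(_ 0)[B [_ hB]].
pose S := [set y | p.[y] <= 0].
have ubS y : S y -> y <= B.
  by move=> Sy; rewrite leNgt; apply/negP => /hB; rewrite ltNge Sy.
have hS : has_sup S by split; [exists a | exists B].
have gtS y : sup S < y -> 0 < p.[y].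
  move=> Sy; rewrite ltNge; apply/negP => /(ub_le_sup hS.2).
  by rewrite leNgt Sy.
have cp := @continuous_horner R p (sup S).
have root_sup : p.[sup S] = 0.
  apply/eqP; rewrite eq_le; apply/andP; split; rewrite leNgt; apply/negP => p0.
    have /nbhs_ballP[d /= d0 hd] : \forall y \near sup S, 0 < p.[y].
      exact: (cvgr_gt _ cp).
    have [y Sy ydS] := sup_adherent d0 hS.
    have yS : y <= sup S by exact: (ub_le_sup hS.2).
    have : 0 < p.[y] by apply: hd; rewrite /ball/= ger0_norm; lra.
    by rewrite ltNge Sy.
  have /nbhs_ballP[d /= d0 hd] : \forall y \near sup S, p.[y] < 0.
    exact: (cvgr_lt _ cp).
  have : p.[sup S + d / 2] < 0.
    by apply: hd; rewrite /ball/= opprD addNKr normrN gtr0_norm; lra.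
  by rewrite ltNge (ltW (gtS _ _))// ltrDl divr_gt0.
exists (sup S); split => //; split; first exact/rootP.
by move=> y /rootP py; apply: (ub_le_sup hS.2); rewrite /S/= py.
Qed.

Lemma cvg_mulX_add_pinfty (f : R -> R) (d : R) :
  f x @[x --> +oo] --> +oo -> x * f x + d @[x --> +oo] --> +oo.
Proof.
move=> /cvgryPge fy; apply/cvgryPge => A; near=> x.
have x1 : 1 <= x by near: x; exact: nbhs_pinfty_ge.
have f0 : `|A - d| <= f x by near: x; exact: fy.
have : f x <= x * f x by rewrite ler_peMl// (le_trans _ f0).
have := ler_norm (A - d); lra.
Unshelve. all: by end_near. Qed.

Lemma cvg_mulX_pinfty (c d : R) : 0 < c -> x * c + d @[x --> +oo] --> +oo.
Proof.
move=> c0; apply/cvgryPge => A; near=> x.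
rewrite -lerBlDr -ler_pdivrMr//; near: x; exact: nbhs_pinfty_ge.
Unshelve. all: by end_near. Qed.

Lemma horner_poly_n1 s e x : (poly_n1 s e).[x] =
  (- e ^+ 2 - 2 * e) * x ^+ 4
  + (- 27 + (18 * s + 48) * (1 + e) ^+ 2) * x ^+ 3
  + ((- 36 * s ^+ 2 - 96 * s - 144) * (1 + e) ^+ 2
      - 24 * s ^+ 2 - 30 * s + 88) * x ^+ 2
  + ((24 * s ^+ 3 + 192 * s ^+ 2 + 288 * s + 192) * (1 + e) ^+ 2
      + 60 * s ^+ 2 + 64 * s - 144) * x
  + (48 * s ^+ 4 + 216 * s ^+ 3 + 352 * s ^+ 2 + 288 * s + 192).
Proof. by rewrite /poly_n1 !(hornerD, hornerZ, hornerXn, hornerX, hornerC). Qed.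

Lemma horner_poly_n2 s e x : (poly_n2 s e).[x] =
  (e ^+ 2 + 2 * e) * x ^+ 6
  - (2 * (1 - e) ^+ 3) * x ^+ 5
  + (18 * (1 - e) ^+ 2 - 18 * s - 39) * x ^+ 4
  + (- 4 * (1 - e) ^+ 3 * s - 6 * (1 - e)) * x ^+ 3
  + ((12 * s ^+ 2 + 36 * s) * (1 - e) ^+ 2
      + 36 * s ^+ 2 + 144 * s + 158) * x ^+ 2
  - (12 * (1 - e) * s) * x
  + (- 24 * s ^+ 3 - 132 * s ^+ 2 - 260 * s - 192).
Proof.
by rewrite /poly_n2 !(hornerD, hornerN, hornerZ, hornerXn, hornerX, hornerC).
Qed.

(** The quartic is affine in (1 + e)^2: [n1_at1 s x] is its value when (1 + e)^2
    is replaced by 1, and [x * n1_slope s x] is its slope. *)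
Definition n1_at1 s x := (18 * s + 21) * x ^+ 3
  - (60 * s ^+ 2 + 126 * s + 56) * x ^+ 2
  + (24 * s ^+ 3 + 252 * s ^+ 2 + 352 * s + 48) * x
  + (48 * s ^+ 4 + 216 * s ^+ 3 + 352 * s ^+ 2 + 288 * s + 192).

Definition n1_slope s x := - x ^+ 3 + (18 * s + 48) * x ^+ 2
  - (36 * s ^+ 2 + 96 * s + 144) * x
  + (24 * s ^+ 3 + 192 * s ^+ 2 + 288 * s + 192).

Lemma n1_at1_ge0 s u : 0 <= s -> 0 <= u -> 0 <= n1_at1 s (2 * s + u).
Proof.
move=> s0 u0.
have cubic : 0 <= 21 * u ^+ 3 - 56 * u ^+ 2 + 48 * u + 192.
  have : 0 <= u * (u - 4 / 3) ^+ 2 by rewrite mulr_ge0 ?sqr_ge0.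
  lra.
have pos i j : 0 <= s ^+ i * u ^+ j by rewrite mulr_ge0 ?exprn_ge0.
have -> : n1_at1 s (2 * s + u) = 18 * (s ^+ 1 * u ^+ 3) + 48 * (s ^+ 2 * u ^+ 2)
    + 384 * (s ^+ 3 * u ^+ 0) + 128 * (s ^+ 1 * u ^+ 1)
    + 832 * (s ^+ 2 * u ^+ 0)
    + 384 * (s ^+ 1 * u ^+ 0) + (21 * u ^+ 3 - 56 * u ^+ 2 + 48 * u + 192).
  by rewrite /n1_at1; ring.
apply: addr_ge0 cubic.
by do 5 (apply: addr_ge0; last exact: mulr_ge0 (ler0n _ _) (pos _ _));
  exact: mulr_ge0 (ler0n _ _) (pos _ _).
Qed.

Lemma n1_end_ge0 s u : 0 <= s -> 0 <= u ->
  0 <= n1_at1 s (2 * s + u) + (2 * s + 1) * n1_slope s (2 * s + u).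
Proof.
move=> s0 u0.
have cubic : 0 <= 20 * u ^+ 3 - 8 * u ^+ 2 - 96 * u + 384.
  have : 0 <= u * (u - 1) ^+ 2 by rewrite mulr_ge0 ?sqr_ge0.
  have := sqr_ge0 (u - 2); lra.
have quadratic : 0 <= s * (108 * u ^+ 2 - 64 * u + 768).
  apply: (mulr_ge0 s0); have := sqr_ge0 (u - 1); have := sqr_ge0 u; lra.
have pos i j : 0 <= s ^+ i * u ^+ j by rewrite mulr_ge0 ?exprn_ge0.
have -> : n1_at1 s (2 * s + u) + (2 * s + 1) * n1_slope s (2 * s + u) =
    16 * (s ^+ 1 * u ^+ 3) + 72 * (s ^+ 2 * u ^+ 2)
    + 48 * (s ^+ 3 * u ^+ 1) + 32 * (s ^+ 4 * u ^+ 0) + 216 * (s ^+ 2 * u ^+ 1)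
    + 784 * (s ^+ 3 * u ^+ 0) + 1024 * (s ^+ 2 * u ^+ 0)
    + s * (108 * u ^+ 2 - 64 * u + 768)
    + (20 * u ^+ 3 - 8 * u ^+ 2 - 96 * u + 384).
  by rewrite /n1_at1 /n1_slope; ring.
apply: addr_ge0 cubic; apply: addr_ge0 quadratic.
by do 6 (apply: addr_ge0; last exact: mulr_ge0 (ler0n _ _) (pos _ _));
  exact: mulr_ge0 (ler0n _ _) (pos _ _).
Qed.

(** Since the quartic is affine in (1 + e)^2, it suffices to check the two ends
    1 and 1 + (2 * s + 1) / x of the range of (1 + e)^2. *)
Lemma poly_n1_ge0 s e x : 0 < s -> 0 < e -> 2 * s < x ->
  (1 + e) ^+ 2 * x <= x + 2 * s + 1 -> 0 <= (poly_n1 s e).[x].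
Proof.
move=> s0 e0 sx ex.
set A1 := n1_at1 s x; set A2 := A1 + (2 * s + 1) * n1_slope s x.
have A1_ge0 : 0 <= A1.
  by rewrite /A1 -(subrKC (2 * s) x); apply: n1_at1_ge0; lra.
have A2_ge0 : 0 <= A2.
  by rewrite /A2 /A1 -(subrKC (2 * s) x); apply: n1_end_ge0; lra.
pose w := ((1 + e) ^+ 2 - 1) * x.
have w0 : 0 <= w.
  apply: mulr_ge0; last by lra.
  by rewrite subr_ge0 exprn_ege1// lerDl ltW.
have w1 : w <= 2 * s + 1 by rewrite /w; lra.
have s1 : 0 < 2 * s + 1 by lra.
rewrite -(pmulr_rge0 _ s1).
have -> : (2 * s + 1) * (poly_n1 s e).[x] = (2 * s + 1 - w) * A1 + w * A2.
  by rewrite horner_poly_n1 /A2 /A1 /n1_at1 /n1_slope /w; ring.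
by rewrite addr_ge0// mulr_ge0// subr_ge0.
Qed.

(** The relation between s, t and z = (1 - e) * t eliminates s and e. After the
    shift z = 1 + x, t = z + y the polynomial in x and y has only three positive
    coefficients, those of x, x^2 and x^3; they are absorbed by the constraint
    t^2 - z^2 >= 3, that is y * (y + 2 * x + 2) >= 3. *)
Lemma poly_n2_le0 s e t : 0 < t -> 0 < s -> 1 < (1 - e) * t ->
  t ^+ 2 - ((1 - e) * t) ^+ 2 = 2 * s + 3 -> (poly_n2 s e).[t] <= 0.
Proof.
move=> t0 s0; set z := (1 - e) * t => z1 tz.
have tn0 : t != 0 by rewrite gt_eqF.
have ez : e = 1 - z / t by rewrite /z; field.
have sz : s = (t ^+ 2 - z ^+ 2 - 3) / 2 by rewrite tz; field.
have zt : z < t.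
  have [//|tz'] := ltP z t; nra.
pose x := z - 1; pose y := t - z.
have x0 : 0 <= x by rewrite /x; lra.
have y0 : 0 <= y by rewrite /y; lra.
have xy : 3 <= y * (y + 2 * x + 2) by rewrite /x /y; nra.
have -> : (poly_n2 s e).[t] =
  6 * z ^+ 6 - 6 * t ^+ 2 * z ^+ 4 + 4 * t ^+ 4 * z ^+ 2
  - 4 * t ^+ 5 * z + 2 * z ^+ 5 - 4 * t ^+ 2 * z ^+ 3 - 6 * z ^+ 4
  + 12 * t ^+ 2 * z ^+ 2 + 12 * z ^+ 3 - 12 * t ^+ 2 * z - 14 * z ^+ 2
  + 10 * t ^+ 2 + 18 * z - 18.
  rewrite horner_poly_n2 ez sz; field; exact: tn0.
have zx : z = 1 + x by rewrite /x; ring.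
have ty : t = 1 + x + y by rewrite /x /y; ring.
have pos i j : 0 <= x ^+ i * y ^+ j by rewrite mulr_ge0 ?exprn_ge0.
have h i : 0 <= x ^+ i * (y * (y + 2 * x + 2) - 3).
  by apply: mulr_ge0; [exact: exprn_ge0|rewrite subr_ge0].
rewrite zx ty -oppr_ge0 -(pmulr_rge0 _ (ltr0n R 3)).
set P := (X in 0 <= X).
have -> : P = 24 * (x ^+ 1 * (y * (y + 2 * x + 2) - 3))
    + 12 * (x ^+ 2 * (y * (y + 2 * x + 2) - 3))
    + 4 * (x ^+ 3 * (y * (y + 2 * x + 2) - 3)) + (
    48 * (x ^+ 5 * y ^+ 1) + 66 * (x ^+ 4 * y ^+ 2) + 72 * (x ^+ 3 * y
    ^+ 3) + 48 * (x ^+ 2 * y ^+ 4) + 12 * (x ^+ 1 * y ^+ 5) + 6 * (x ^+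
    5 * y ^+ 0) + 256 * (x ^+ 4 * y ^+ 1) + 272 * (x ^+ 3 * y ^+ 2) +
    216 * (x ^+ 2 * y ^+ 3) + 96 * (x ^+ 1 * y ^+ 4) + 12 * (x ^+ 0 * y
    ^+ 5) + 12 * (x ^+ 4 * y ^+ 0) + 472 * (x ^+ 3 * y ^+ 1) + 384 * (x
    ^+ 2 * y ^+ 2) + 216 * (x ^+ 1 * y ^+ 3) + 48 * (x ^+ 0 * y ^+ 4) +
    408 * (x ^+ 2 * y ^+ 1) + 240 * (x ^+ 1 * y ^+ 2) + 72 * (x ^+ 0 * y
    ^+ 3) + 156 * (x ^+ 1 * y ^+ 1) + 48 * (x ^+ 0 * y ^+ 2) + 12 * (x
    ^+ 0 * y ^+ 1)).
  by rewrite /P; ring.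
apply: addr_ge0; last first.
  do 21 (apply: addr_ge0; last exact: mulr_ge0 (ler0n _ _) (pos _ _)).
  exact: mulr_ge0 (ler0n _ _) (pos _ _).
do 2 (apply: addr_ge0; last exact: mulr_ge0 (ler0n _ _) (h _)).
exact: mulr_ge0 (ler0n _ _) (h _).
Qed.

Lemma largest_root_poly_n1 s e : 0 < s -> 0 < e ->
  exists x, largest_root (poly_n1 s e) x /\
    forall y, x < y -> (poly_n1 s e).[y] < 0.
Proof.
move=> s0 e0.
have [||x [[rx lx] px]] := @largest_root_exists (- poly_n1 s e) 0.
- rewrite hornerN horner_poly_n1 !expr0n /= !mulr0 !add0r oppr_le0.
  have := exprn_gt0 4 s0; have := exprn_gt0 3 s0; have := exprn_gt0 2 s0; lra.
- have c4 : 0 < e ^+ 2 + 2 * e by have := exprn_gt0 2 e0; lra.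
  rewrite (_ : horner _ = fun x => x * (x * (x * (x * (e ^+ 2 + 2 * e)
    + - (- 27 + (18 * s + 48) * (1 + e) ^+ 2))
    + - ((- 36 * s ^+ 2 - 96 * s - 144) * (1 + e) ^+ 2
         - 24 * s ^+ 2 - 30 * s + 88))
    + - ((24 * s ^+ 3 + 192 * s ^+ 2 + 288 * s + 192) * (1 + e) ^+ 2
         + 60 * s ^+ 2 + 64 * s - 144))
    + - (48 * s ^+ 4 + 216 * s ^+ 3 + 352 * s ^+ 2 + 288 * s + 192)).
    by do 3 apply: cvg_mulX_add_pinfty; exact: cvg_mulX_pinfty.
  by apply/funext => x; rewrite hornerN horner_poly_n1; ring.
exists x; split; first split.
- by rewrite -rootN.
- by move=> y ry; apply: lx; rewrite rootN.
- by move=> y /px; rewrite hornerN oppr_gt0.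
Qed.

Lemma largest_root_poly_n2 s e : 0 < s -> 0 < e ->
  exists x, largest_root (poly_n2 s e) x /\
    forall y, x < y -> 0 < (poly_n2 s e).[y].
Proof.
move=> s0 e0; apply: (@largest_root_exists (poly_n2 s e) 0).
  rewrite horner_poly_n2 !expr0n /= !mulr0 subr0 !addr0 !add0r.
  have := exprn_gt0 2 s0; have := exprn_gt0 3 s0; lra.
have c6 : 0 < e ^+ 2 + 2 * e by have := exprn_gt0 2 e0; lra.
rewrite (_ : horner _ = fun x => x * (x * (x * (x * (x * (x * (e ^+ 2 + 2 * e)
  + - (2 * (1 - e) ^+ 3)) + (18 * (1 - e) ^+ 2 - 18 * s - 39))
  + (- 4 * (1 - e) ^+ 3 * s - 6 * (1 - e)))
  + ((12 * s ^+ 2 + 36 * s) * (1 - e) ^+ 2 + 36 * s ^+ 2 + 144 * s + 158))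
  + - (12 * (1 - e) * s)) + (- 24 * s ^+ 3 - 132 * s ^+ 2 - 260 * s - 192)).
  by do 5 apply: cvg_mulX_add_pinfty; exact: cvg_mulX_pinfty.
by apply/funext => x; rewrite horner_poly_n2; ring.
Qed.

End threshold_polynomials.

(** * Bounds on the root *)

Section root_bounds.
Variables (R : realType) (s : R).

(** The function depends on a only through r = a * sqrt n / 2; these properties
    of it are all that the bounds on its root need. *)
Lemma f_fun_profile n (p := n%:R / 4 + s / 2) (q := n%:R / 4 - s / 2) :
  0 < s -> 2 * s < n%:R -> exists g : R -> R,
  [/\ forall a, f_fun n s a = g (a * Num.sqrt n%:R / 2),
      forall a b, 0 <= a -> a < b -> b < q + 1 / 2 -> g b < g a,
      exists2 r, 1 / 2 < r < q + 1 / 2 & g r = 0,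
      forall r, 1 / 2 <= r -> r < q + 1 / 2 -> p < r ^+ 2 - 1 / 4 -> g r < 0 &
      forall r, 1 / 2 <= r -> r ^+ 2 - 1 / 4 < q - 1 -> 0 < g r].
Proof.
move=> s0 ns.
have q0 : 0 < q by rewrite /q; lra.
have qp : q < p by rewrite /q /p; lra.
have Ls := @lnGamma_succ R; have Lc := @lnGamma_convex R.
exists (fun r => spread (@lnGamma R) p r - spread (@lnGamma R) q r).
split=> [a|a b||r|r].
- by rewrite /f_fun /spread /p /q; move: (@lnGamma R) => L; ring.
- exact: spread_diff_decreasing.
- exact: spread_diff_root.
- exact: spread_diff_lt0.
- exact: spread_diff_gt0.
Qed.

Lemma a_root_spec n : 0 < s -> 2 * s < n%:R ->
  exists r, [/\ a_root n s = 2 * r / Num.sqrt n%:R, 1 / 2 < r,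
    n%:R / 4 - s / 2 <= r ^+ 2 + 3 / 4 & r ^+ 2 <= n%:R / 4 + s / 2 + 1 / 4].
Proof.
move=> s0 ns.
have [g [fg dec [r /andP[r1 rq] gr] g_lt0 g_gt0]] := f_fun_profile s0 ns.
move: fg dec rq g_lt0 g_gt0; set N : R := n%:R in ns *.
set p := N / 4 + s / 2; set q := N / 4 - s / 2 => fg dec rq g_lt0 g_gt0.
have N0 : 0 < N by lra.
have t0 : 0 < Num.sqrt N by rewrite sqrtr_gt0.
have tn0 : Num.sqrt N != 0 by rewrite gt_eqF.
set t := Num.sqrt N in fg t0 tn0 *.
have e a : a * t / 2 < q + 1 / 2 <-> a < 1 / 2 * ((N - 2 * s) / t) + 1 / t.
  have -> : 1 / 2 * ((N - 2 * s) / t) + 1 / t = 2 * (q + 1 / 2) / t.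
    by rewrite /q; field.
  by rewrite ltr_pdivrMr// ltr_pdivlMr// [_ * 2]mulrC.
exists r; split => //; last 2 first.
- rewrite leNgt; apply/negP => h.
  have : r ^+ 2 - 1 / 4 < q - 1 by lra.
  by move=> /(g_gt0 _ (ltW r1)); rewrite gr ltxx.
- rewrite leNgt; apply/negP => h.
  have : p < r ^+ 2 - 1 / 4 by lra.
  by move=> /(g_lt0 _ (ltW r1) rq); rewrite gr ltxx.
have ar : 2 * r / t * t / 2 = r by field.
have pr : positive_root n s (2 * r / t).
  have a0 : 0 < 2 * r / t by rewrite divr_gt0// mulr_gt0//; lra.
  have ab : 2 * r / t < 1 / 2 * ((N - 2 * s) / t) + 1 / t.
    by apply/e; rewrite ar.
  split; [exact: a0| |by rewrite fg ar].
  by rewrite /f_dom /= -/N -/t; split; [lra|exact: ab].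
have u : unique (positive_root n s) (2 * r / t).
  split; first exact: pr.
  move=> a [a0 [_ ab]]; rewrite fg => fa.
  have {}ab : a * t / 2 < q + 1 / 2 by apply/e.
  have at0 : 0 < a * t / 2 by rewrite divr_gt0// mulr_gt0.
  have [ar'|ar'|ar'] := ltgtP (a * t / 2) r.
  - by have := dec _ _ (ltW at0) ar' rq; rewrite fa gr ltxx.
  - have r0 : 0 <= r by lra.
    by have := dec _ _ r0 ar' ab; rewrite fa gr ltxx.
  - by rewrite -ar'; field.
have ex : exists a, [set a | unique (positive_root n s) a] a.
  by exists (2 * r / t).
have [pa _] := xgetPex 0 ex.
by have [_ /(_ _ pa)] := u.
Qed.

Lemma a_root_lt n c : 0 < s -> 2 * s < n%:R -> 0 < c ->
  n%:R + 2 * s + 1 < c ^+ 2 * n%:R -> a_root n s < c.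
Proof.
move=> s0 ns c0 cn; have [r [-> r1 _ rp]] := a_root_spec s0 ns.
move: rp; set N : R := n%:R in ns cn * => rp.
have N0 : 0 < N by lra.
have t0 : 0 < Num.sqrt N by rewrite sqrtr_gt0.
have tN : Num.sqrt N ^+ 2 = N by rewrite sqr_sqrtr// ltW.
set t := Num.sqrt N in t0 tN *.
rewrite ltr_pdivrMr//.
have -> : (2 * r < c * t) = ((2 * r) ^+ 2 < (c * t) ^+ 2).
  by rewrite ltr_pXn2r// nnegrE; [lra|rewrite mulr_ge0// ltW].
by rewrite !exprMn tN; lra.
Qed.

Lemma a_root_gt n c : 0 < s -> 2 * s < n%:R -> 0 < c ->
  c ^+ 2 * n%:R < n%:R - 2 * s - 3 -> c < a_root n s.
Proof.
move=> s0 ns c0 cn; have [r [-> r1 rq _]] := a_root_spec s0 ns.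
move: rq; set N : R := n%:R in ns cn * => rq.
have N0 : 0 < N by lra.
have t0 : 0 < Num.sqrt N by rewrite sqrtr_gt0.
have tN : Num.sqrt N ^+ 2 = N by rewrite sqr_sqrtr// ltW.
set t := Num.sqrt N in t0 tN *.
rewrite ltr_pdivlMr//.
have -> : (c * t < 2 * r) = ((c * t) ^+ 2 < (2 * r) ^+ 2).
  by rewrite ltr_pXn2r// nnegrE; [rewrite mulr_ge0// ltW|lra].
by rewrite !exprMn tN; lra.
Qed.

Lemma inv_sqrt_lt_a_root n :
  0 < s -> 2 * s < n%:R -> 1 / Num.sqrt n%:R < a_root n s.
Proof.
move=> s0 ns; have [r [-> r1 _ _]] := a_root_spec s0 ns.
rewrite ltr_pM2r ?invr_gt0 ?sqrtr_gt0; lra.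
Qed.

Lemma a_root_lt_of_poly_n1 e n : 0 < s -> 0 < e -> 2 * s < n%:R ->
  (poly_n1 s e).[n%:R] < 0 ->
  a_root n s < 1 + e.
Proof.
move=> s0 e0 ns; rewrite ltNge => /negP h; apply: a_root_lt => //; first by lra.
by rewrite ltNge; apply/negP => /(poly_n1_ge0 s0 e0 ns).
Qed.

(** For c = 1 - e there are three cases: c * sqrt n <= 1, where
    1 / sqrt n < a_root n s applies; c^2 * n < n - 2 * s - 3, where [a_root_gt]
    applies; and the remaining one, where the polynomial is nonpositive at some
    T >= sqrt n. *)
Lemma a_root_gt_of_poly_n2 e n : 0 < s -> 0 < e -> 2 * s < n%:R ->
  (forall t, Num.sqrt n%:R <= t -> 0 < (poly_n2 s e).[t]) ->
  1 - e < a_root n s.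
Proof.
move=> s0 e0 ns h; have := inv_sqrt_lt_a_root s0 ns.
set N : R := n%:R in ns h *.
have N0 : 0 < N by apply: lt_trans ns; rewrite mulr_gt0.
have t0 : 0 < Num.sqrt N by rewrite sqrtr_gt0.
have tN : Num.sqrt N ^+ 2 = N by rewrite sqr_sqrtr// ltW.
set t := Num.sqrt N in t0 tN h * => ra.
set c := 1 - e.
have [ct|ct] := leP (c * t) 1.
  by apply: le_lt_trans ra; rewrite ler_pdivlMr.
have c0 : 0 < c by rewrite -(pmulr_lgt0 _ t0); lra.
have [cn|cn] := ltP (c ^+ 2 * N) (N - 2 * s - 3); first exact: a_root_gt.
have c1 : 0 < 1 - c ^+ 2 by rewrite subr_gt0 expr_lt1// ?ltW// /c; lra.
pose T2 := (2 * s + 3) / (1 - c ^+ 2).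
have NT : N <= T2 by rewrite ler_pdivlMr//; lra.
pose T := Num.sqrt T2.
have T2E : T ^+ 2 = T2 by rewrite sqr_sqrtr//; lra.
have tT : t <= T by rewrite ler_wsqrtr.
have := h T tT; rewrite ltNge => /negP; case.
apply: poly_n2_le0 => //; first exact: lt_le_trans tT.
  by rewrite -/c; apply: (lt_le_trans ct); rewrite ler_pM2l.
by rewrite -/c exprMn T2E /T2; field; rewrite gt_eqF.
Qed.

End root_bounds.

Theorem theorem1p3 (R : realType) (s : R) (hs : 0 < s) :
  [/\ (forall e1 : R, 0 < e1 ->
         exists n1 : R, largest_root (poly_n1 s e1) n1 /\
           forall n : nat, (0 < n)%N -> 2 * s < n%:R ->
             Num.max (sqrt_bound s (1 + e1)) n1 < n%:R ->
             a_root n s < 1 + e1),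
      (forall e2 : R, 0 < e2 ->
         exists n2 : R,
           (exists t : R, largest_root (poly_n2 s e2) t /\ n2 = t ^+ 2) /\
           forall n : nat, (0 < n)%N -> 2 * s < n%:R ->
             Num.max (sqrt_bound s (1 - e2)) n2 < n%:R ->
             1 - e2 < a_root n s) &
      a_root n s @[n --> \oo] --> (1 : R) ].
Proof.
have upper e : 0 < e -> exists n1 : R, largest_root (poly_n1 s e) n1 /\
    forall n : nat, 2 * s < n%:R -> n1 < n%:R -> a_root n s < 1 + e.
  move=> e0; have [n1 [ln1 pn1]] := largest_root_poly_n1 hs e0.
  exists n1; split => // n ns n1n.
  by apply: a_root_lt_of_poly_n1 => //; exact: pn1.
have lower e : 0 < e -> exists t : R, largest_root (poly_n2 s e) t /\
    forall n : nat, 2 * s < n%:R -> t ^+ 2 < n%:R -> 1 - e < a_root n s.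
  move=> e0; have [t [lt pt]] := largest_root_poly_n2 hs e0.
  exists t; split => // n ns tn; apply: a_root_gt_of_poly_n2 => // u nu.
  apply: pt; apply: lt_le_trans nu; apply: (le_lt_trans (ler_norm t)).
  by rewrite -sqrtr_sqr ltr_sqrt//; lra.
split.
- move=> e /upper[n1 [ln1 h]]; exists n1; split => // n _ ns.
  by rewrite gt_max => /andP[_]; exact: h.
- move=> e /lower[t [lt h]]; exists (t ^+ 2); split; first by exists t.
  by move=> n _ ns; rewrite gt_max => /andP[_]; exact: h.
- apply/cvgrPdist_lt => e e0.
  have [n1 [_ h1]] := upper e e0; have [t [_ h2]] := lower e e0.
  near=> n.
  have ns : 2 * s < n%:R by near: n; exact: nbhs_infty_gtr.
  have n1n : n1 < n%:R by near: n; exact: nbhs_infty_gtr.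
  have tn : t ^+ 2 < n%:R by near: n; exact: nbhs_infty_gtr.
  have := h1 n ns n1n; have := h2 n ns tn.
  by rewrite ltr_norml => l1 l2; apply/andP; split; lra.
Unshelve. all: by end_near. Qed.
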